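(* Let $\mathbf{X}=\sum_{n\ge 0}\sum_{\pi}\mathbf{G}_\pi$, where for each $n$ the inner sum runs over all alternating signed permutations $\pi$ of size $n$ (the term for $n=0$ is $\mathbf{G}_\emptyset=1$). Then, with $d$ the linear map defined below, extended termwise to formal infinite sums, $$d\mathbf{X}=1+\mathbf{X}^2 .$$
   Context: A signed permutation of size $n$ is a word $\pi=\pi_1\cdots\pi_n$ over the integers such that $|\pi_1|,\dots,|\pi_n|$ is a permutation of $\{1,\dots,n\}$; equivalently a pair $(\sigma,\epsilon)$ with $\sigma\in\mathfrak S_n$, $\epsilon\in\{\pm1\}^n$ and $\pi_i=\epsilon_i\sigma(i)$. A negative letter $-k$ is also written $\bar k$. Letters are compared as integers. For a word $w$ of distinct integers, $\mathrm{std}(w)$ denotes the permutation of $\{1,\dots,|w|\}$ having the same relative order as the letters of $w$. ${\bf FQSym}^{(2)}$ is the algebra with basis $\mathbf{G}_{(\sigma,\epsilon)}$ indexed by signed permutations of all sizes $n\ge0$ (with unit $\mathbf G_\emptyset=1$) and product $\mathbf{G}_{(\alpha,\epsilon)}\mathbf{G}_{(\beta,\eta)}=\sum_{\gamma}\mathbf{G}_{(\gamma,\epsilon\cdot\eta)}$ for $(\alpha,\epsilon)$ of size $k$ and $(\beta,\eta)$ of size $l$, where $\gamma$ runs over the permutations in $\mathfrak S_{k+l}$ with $\mathrm{std}(\gamma_1\cdots\gamma_k)=\alpha$ and $\mathrm{std}(\gamma_{k+1}\cdots\gamma_{k+l})=\beta$, and $\epsilon\cdot\eta$ is the concatenation of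 sign vectors. Identities are taken in the completion consisting of formal infinite sums. A signed permutation $\pi$ of size $n$ is alternating if $\pi_1<\pi_2>\pi_3<\pi_4>\cdots$ (all signed permutations of size $0$ and $1$ are alternating). The linear map $d$ is defined by $d\,\mathbf{G}_\emptyset=0$ and, for $\pi$ of size $n\ge1$: if $\pi=u\,n\,v$ (the letter of absolute value $n$ is positive) then $d\mathbf{G}_\pi=\mathbf{G}_{uv}$, and if $\pi=u\,\bar n\,v$ then $d\mathbf{G}_\pi=\mathbf{G}_{u\bar v}$, where $\bar v$ is the word $v$ with the sign of every letter changed. *)

(* Defs.v *)
From HB Require Import structures.
From mathcomp Require Import all_boot all_order all_algebra all_fingroup.

Set Implicit Arguments.
Unset Strict Implicit.
Unset Printing Implicit Defensive.

Import Order.TTheory GRing.Theory Num.Theory.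
Local Open Scope ring_scope.

(* The pair (sigma, epsilon); positions and values of sigma are shifted to
   0, ..., n-1, and the boolean true stands for the sign -1. *)
Definition sperm (n : nat) := ('S_n * n.-tuple bool)%type.

Definition sp := {n : nat & sperm n}.

Definition pword n (s : 'S_n) : seq int := [seq (s i).+1%:Z | i <- enum 'I_n].

Definition word n (p : sperm n) : seq int :=
  [seq (-1) ^+ tnth p.2 i * (p.1 i).+1%:Z | i <- enum 'I_n].

Definition swd (p : sp) : seq int := word (tagged p).

(* The i-th letter of [std w] is the rank of the i-th letter of w; see
   [std_perm] and [std_mono] for the characterisation when w is duplicate-free. *)
Definition std (w : seq int) : seq int :=
  [seq (count (fun y => y <= x) w)%:Z | x <- w].

(* Positions are counted from 0 here, so the first comparison (i = 0) is <. *)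
Definition alternating (w : seq int) : bool :=
  [forall i : 'I_(size w).-1,
     if odd i then w`_i > w`_i.+1 else w`_i < w`_i.+1].

(* u n v |-> u v  and  u (-n) v |-> u (-v), where n is the length of the word. *)
Definition dword (w : seq int) : seq int :=
  let n := (size w)%:Z in
  if n \in w then
    take (index n w) w ++ drop (index n w).+1 w
  else
    take (index (- n) w) w ++ [seq - x | x <- drop (index (- n) w).+1 w].

Section Series.

Variable R : comNzRingType.

(* A formal infinite sum of the G_p with coefficients in R is the family of its
   coefficients. *)
Definition series := sp -> R.

(* G_p, with p given by its word. *)
Definition Gw (w : seq int) : series := fun q => (swd q == w)%:R.

Definition ser_one : series := Gw [::].

Definition ser_add (F H : series) : series := fun q => F q + H q.

Definition mulG k l (a : sperm k) (b : sperm l) : series := fun q =>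
  \sum_(g : 'S_(k + l) | (std (take k (pword g)) == pword a.1)
                         && (std (drop k (pword g)) == pword b.1))
     Gw (word ((g, [tuple of a.2 ++ b.2]) : sperm (k + l))) q.

(* Bilinear extension of [mulG]: only the pairs of sizes (k, l) with k + l the
   size of q contribute to the coefficient of G_q. *)
Definition ser_mul (F H : series) : series := fun q =>
  \sum_(k < (tag q).+1)
     \sum_(a : sperm k) \sum_(b : sperm (tag q - k))
        F (Tagged sperm a) * H (Tagged sperm b) * mulG a b q.

Definition dG n (p : sperm n) : series := fun q =>
  if n == 0%N then 0 else Gw (dword (word p)) q.

(* Termwise extension of [dG]: only the p whose size is one more than that of q
   contribute to the coefficient of G_q. *)
Definition ser_d (F : series) : series := fun q =>
  \sum_(p : sperm (tag q).+1) F (Tagged sperm p) * dG p q.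

Definition altX : series := fun p => (alternating (swd p))%:R.

End Series.

Lemma size_word n (p : sperm n) : size (word p) = n.
Proof. by rewrite size_map size_enum_ord. Qed.

Lemma nth_word n (p : sperm n) (i : 'I_n) :
  (word p)`_i = (-1) ^+ tnth p.2 i * (p.1 i).+1%:Z.
Proof. by rewrite (nth_map i) ?size_enum_ord // nth_ord_enum. Qed.

Lemma absz_letter n (p : sperm n) (i : 'I_n) :
  absz ((-1) ^+ tnth p.2 i * (p.1 i).+1%:Z) = (p.1 i).+1.
Proof. by rewrite abszM; case: (tnth _ _); rewrite ?mul1n. Qed.

Lemma word_inj n : injective (@word n).
Proof.
move=> [s e] [t f] eq_st.
have eq_i i : (-1) ^+ tnth e i * (s i).+1%:Z = (-1) ^+ tnth f i * (t i).+1%:Z :> int.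
  have := congr1 (fun w : seq int => w`_i) eq_st.
  by rewrite !nth_word.
congr (_, _).
  apply/permP=> i; apply/val_inj.
  have := congr1 absz (eq_i i).
  by rewrite (absz_letter (s, e)) (absz_letter (t, f)) => -[].
apply/eq_from_tnth=> i; move: (eq_i i).
by case: (tnth e i); case: (tnth f i); rewrite ?mulN1r ?mul1r.
Qed.

Lemma swd_inj : injective swd.
Proof.
move=> [n p] [m q] e.
have enm : n = m by move: (congr1 size e); rewrite !size_word.
by subst m; congr existT; apply: word_inj.
Qed.

Lemma perm_word n (p : sperm n) : perm_eq (map absz (word p)) (iota 1 n).
Proof.
rewrite -map_comp (eq_map (g := fun i => (p.1 i).+1)); last exact: absz_letter.
apply: uniq_perm; rewrite ?iota_uniq //.
  rewrite map_inj_uniq ?enum_uniq // => i j [] /val_inj; exact: perm_inj.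
move=> k; rewrite mem_iota add1n; apply/mapP/andP=> [[i _ ->]|[]].
  by split; last exact: ltn_ord.
case: k => // k _ kn; exists ((p.1^-1)%g (Ordinal (kn : k < n)%N)).
  by rewrite mem_enum.
by rewrite permKV.
Qed.

Lemma word_surj n (w : seq int) :
  perm_eq (map absz w) (iota 1 n) -> exists p : sperm n, word p = w.
Proof.
move=> pw.
have sw : size w = n by rewrite -(size_map absz) (perm_size pw) size_iota.
have nz (i : 'I_n) : (0 < absz (w`_i)%R <= n)%N.
  have: absz (w`_i)%R \in iota 1 n.
    by rewrite -(perm_mem pw) map_f // mem_nth // sw.
  by rewrite mem_iota add1n ltnS.
have lt_n (i : 'I_n) : ((absz (w`_i)%R).-1 < n)%N.
  by case/andP: (nz i); case: (absz _).
pose f i := Ordinal (lt_n i).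
have fI : injective f.
  move=> i j [] e; apply/val_inj/eqP.
  rewrite -(nth_uniq 0%N (s := map absz w)) ?size_map ?sw ?ltn_ord //; last first.
    by rewrite (perm_uniq pw) iota_uniq.
  rewrite !(nth_map (0 : int)) ?sw ?ltn_ord //; move: e (nz i) (nz j).
  by case: (absz (w`_i)%R) => // a; case: (absz (w`_j)%R) => // b /= ->.
exists (perm fI, [tuple w`_i < 0 | i < n]).
apply: (@eq_from_nth _ 0); rewrite size_word ?sw // => i ltin.
rewrite (nth_word _ (Ordinal ltin)) /= permE tnth_mktuple /=.
have /andP[] := nz (Ordinal ltin); rewrite /= => /prednK -> _.
by rewrite abszE -intEsign.
Qed.

Lemma size_std w : size (std w) = size w.
Proof. exact: size_map. Qed.

Lemma std_mono w i j : (i < size w)%N -> (j < size w)%N ->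
  ((std w)`_i < (std w)`_j) = (w`_i < w`_j).
Proof.
move=> iw jw; rewrite !(nth_map 0) // ltz_nat.
have [lt_ij|le_ji] := ltP w`_i w`_j; last first.
  by apply/negbTE; rewrite -leqNgt; apply: sub_count => y /= /le_trans ->.
pose P : pred int := fun y => y <= w`_i; pose Q : pred int := pred1 w`_j.
have PQ0 : count (predI P Q) w = 0%N.
  rewrite (eq_count (a2 := pred0)) ?count_pred0 // => y /=.
  apply/negbTE/negP => /andP[]; rewrite /P /Q /= => le_y /eqP ey.
  by move: lt_ij; rewrite -ey ltNge le_y.
have Qpos : (0 < count Q w)%N by rewrite -has_count has_pred1 mem_nth.
have := count_predUI P Q w; rewrite PQ0 addn0 => ePQ.
apply: (@leq_trans (count P w + count Q w)).
  by rewrite -addn1 leq_add2l.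
rewrite -ePQ; apply: sub_count => y /= /orP[|]; rewrite /P /Q /=.
  by move/le_trans; apply; apply: ltW.
by move/eqP->.
Qed.

Lemma std_perm w : uniq w -> perm_eq (std w) [seq k%:Z | k <- iota 1 (size w)].
Proof.
move=> uw.
have stdI : uniq (std w).
  rewrite map_inj_in_uniq // => x y xw yw e; apply/eqP/negPn/negP => nxy.
  have mono u v (uin : u \in w) (vin : v \in w) : u < v ->
      ((count (fun z => z <= u) w)%:Z < (count (fun z => z <= v) w)%:Z)%R.
    move=> ltuv; have := @std_mono w (index u w) (index v w).
    rewrite !index_mem => /(_ uin vin).
    by rewrite !(nth_map 0) ?index_mem // !nth_index // ltuv.
  by case: (ltgtP x y) nxy => [/(mono _ _ xw yw)|/(mono _ _ yw xw)|//]; rewrite e ltxx.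
apply: uniq_perm => //; first by rewrite map_inj_uniq ?iota_uniq // => i j [].
apply: (uniq_min_size stdI _ _).2; last by rewrite size_map size_iota size_std.
move=> z /mapP[x xw ->]; apply: map_f.
by rewrite mem_iota add1n ltnS count_size -has_count; apply/andP; split=> //; apply/hasP; exists x.
Qed.

Lemma dword_perm n w : perm_eq (map absz w) (iota 1 n.+1) ->
  perm_eq (map absz (dword w)) (iota 1 n).
Proof.
move=> pw.
have sw : size w = n.+1 by rewrite -(size_map absz) (perm_size pw) size_iota.
have split_w (x : int) (v : seq int) : x \in w -> absz x = n.+1 ->
    map absz v = map absz (drop (index x w).+1 w) ->
    perm_eq (map absz (take (index x w) w ++ v)) (iota 1 n).
  move=> xw ax av; rewrite map_cat av -(perm_cons n.+1).
  apply: (perm_trans (y := map absz w)); last first.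
    apply: perm_trans pw _.
    have -> : iota 1 n.+1 = iota 1 n ++ [:: n.+1] by have := iotaD 1 n 1; rewrite addn1 add1n.
    by rewrite perm_catC.
  rewrite -[in X in perm_eq _ X](cat_take_drop (index x w) w).
  rewrite [drop (index x w) w](drop_nth (0 : int)) ?index_mem //.
  rewrite nth_index // map_cat /= ax perm_sym.
  exact: (permEl (perm_catCA _ [:: n.+1] _)).
rewrite /dword sw; case: ifP => [nw|nw]; first exact: split_w.
apply: split_w => //; last first.
  by rewrite -map_comp; apply: eq_map => x /=; rewrite abszN.
have: n.+1 \in map absz w by rewrite (perm_mem pw) mem_iota add1n ltnSn.
case/mapP=> -[m|m] xw /= e; first by rewrite e xw in nw.
by rewrite e -NegzE.
Qed.

Lemma dG_basis (R : comNzRingType) n (p : sperm n.+1) :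
  exists q : sperm n, dG R p = Gw R (word q).
Proof.
by have [q e] := word_surj (dword_perm (perm_word p)); exists q; rewrite e.
Qed.

Lemma Gw_size (R : comNzRingType) n (p : sperm n) q :
  tag q != n -> Gw R (word p) q = 0.
Proof.
move=> nq; rewrite /Gw; case: eqP => // e; case/eqP: nq.
by rewrite -(size_word (tagged q)) -/(swd q) e size_word.
Qed.

Lemma Gw_eq (R : comNzRingType) n (p p' : sperm n) :
  Gw R (word p) (Tagged sperm p') = (p' == p)%:R.
Proof. by rewrite /Gw /swd (inj_eq (@word_inj n)). Qed.

Lemma ser_d_basis (R : comNzRingType) n (p : sperm n) :
  ser_d (Gw R (word p)) =1 dG R p.
Proof.
move=> q; rewrite /ser_d; have [e|nq] := eqVneq (tag q).+1 n.
  subst n; rewrite (bigD1 p) //= Gw_eq eqxx mul1r big1 ?addr0 // => p' np.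
  by rewrite Gw_eq (negbTE np) mul0r.
rewrite big1 => [|p' _]; last by rewrite Gw_size ?mul0r.
case: n p nq => [//|n] p nq; have [r ->] := dG_basis R p.
by rewrite Gw_size.
Qed.

Lemma ser_mul_basis (R : comNzRingType) k l (a : sperm k) (b : sperm l) :
  ser_mul (Gw R (word a)) (Gw R (word b)) =1 mulG R a b.
Proof.
move=> q; rewrite /ser_mul; have [e|nq] := eqVneq (tag q) (k + l)%N; last first.
  rewrite [RHS]big1 => [|g _]; last by rewrite Gw_size.
  apply: big1 => i _; apply: big1 => a' _; apply: big1 => b' _.
  have [ei|ni] := eqVneq (i : nat) k; last by rewrite Gw_size ?mul0r.
  rewrite [X in _ * X * _]Gw_size ?mulr0 ?mul0r //=.
  apply: contraNneq nq => <-; rewrite -ei subnKC //; exact: (ltn_ord i).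
have kq : (k < (tag q).+1)%N by rewrite e ltnS leq_addr.
rewrite (bigD1 (Ordinal kq)) //= [X in _ + X]big1 ?addr0; last first.
  move=> i ni; apply: big1 => a' _; apply: big1 => b' _.
  rewrite Gw_size ?mul0r //; apply: contraNneq ni.
rewrite (bigD1 a) //= [X in _ + X]big1 ?addr0; last first.
  by move=> a' na; apply: big1 => b' _; rewrite Gw_eq (negbTE na) !mul0r.
have el : (tag q - k = l)%N by rewrite e addKn.
rewrite el (bigD1 b) //= !Gw_eq !eqxx !mul1r big1 ?addr0 // => b' nb.
by rewrite Gw_eq (negbTE nb) mulr0 mul0r.
Qed.

(* Main.v *)
Require Import Defs.
From mathcomp Require Import all_boot all_order all_algebra all_fingroup zify.

(** Let w be a word of size n. The coefficient of G_w in X^2 counts the k such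
    that the prefix u of size k of w = u v and the suffix v are both alternating,
    since standardization of absolute values under fixed signs preserves the
    order of the letters. The coefficient in d X counts the alternating words
    among u (n+1) v and u (-(n+1)) (-v): for k odd only the former can be
    alternating (a maximum sits at a peak), for k even only the latter (a
    minimum sits in a valley, and negation exchanges peaks and valleys of v), in
    both cases exactly when u and v are alternating. The empty word is the
    exception: both (1) and (-1) are alternating, which gives the extra 1. *)

Set Implicit Arguments.
Unset Strict Implicit.
Unset Printing Implicit Defensive.

Import Order.TTheory GRing.Theory Num.Theory.
Local Open Scope ring_scope.

(** * Zigzag words and the insertion of a letter of largest absolute value *)

(** The flag [up] is the direction of the first comparison. Carrying it makes the condition
    recursive, so that it can be followed through suffixes starting at any parity and through
    negation. *)
Fixpoint zigzag (up : bool) (w : seq int) : bool :=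
  if w is x :: w' then
    (if w' is y :: _ then if up then x < y else y < x else true)
    && zigzag (~~ up) w'
  else true.

Lemma zigzag_nth up (w : seq int) :
  zigzag up w = [forall i : 'I_(size w).-1,
     if odd i (+) up then w`_i < w`_i.+1 else w`_i > w`_i.+1].
Proof.
elim: w up => [|x [|y w] IH] up /=; try by apply/esym/forallP => -[].
rewrite -/(zigzag (~~ up) (y :: w)) IH.
apply/andP/forallP => [[xy /forallP yw] [[|i] lti]|xyw].
- by move: xy; case: up {yw}.
- by have := yw (Ordinal (lti : (i < (size (y :: w)).-1)%N)); rewrite /= addbN addNb.
split; first by have := xyw ord0; case: up {xyw}.
apply/forallP => i; have := xyw (lift ord0 i).
by rewrite lift0 /= addbN addNb.
Qed.

Lemma alternating_zigzag w : alternating w = zigzag true w.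
Proof.
by rewrite zigzag_nth; apply: eq_forallb => i; rewrite addbT; case: odd.
Qed.

Lemma alternating_eq (w w' : seq int) : size w = size w' ->
  (forall i j, (i < size w)%N -> (j < size w)%N ->
     (w`_i < w`_j) = (w'`_i < w'`_j)) ->
  alternating w = alternating w'.
Proof.
move=> sz ww'; rewrite /alternating -sz; apply: eq_forallb => -[i /= lti].
by rewrite !ww' //; lia.
Qed.

(** The letter x is kept in both factors so that its comparisons with both neighbours survive the
    splitting. *)
Lemma zigzag_cat up u x v :
  zigzag up (u ++ x :: v)
  = zigzag up (rcons u x) && zigzag (up (+) odd (size u)) (x :: v).
Proof.
elim: u up => [|y u IH] up; first by rewrite addbF.
rewrite rcons_cons !cat_cons /= -/(zigzag _ (x :: v)) IH addbN addNb -andbA.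
by case: u {IH}.
Qed.

Lemma zigzag_rcons up u x :
  zigzag up (rcons u x)
  = zigzag up u && (nilp u || (if up (+) odd (size u) then last 0 u > x
                               else last 0 u < x)).
Proof.
elim: u up => [//|y u IH] up; rewrite rcons_cons /= IH addbN -addNb.
by case: u {IH} => [|z u] /=; rewrite ?andbT //; case: up; rewrite ?andbA.
Qed.

Lemma zigzag_opp up w : zigzag up [seq - x | x <- w] = zigzag (~~ up) w.
Proof.
elim: w up => [//|x w IH] up /=; rewrite IH.
by case: w {IH} => [//|y w] /=; rewrite !ltrN2; case: up.
Qed.

(* The two preimages of w under [dword] whose letter of largest absolute value
   is in position k; s is the sign of that letter. *)
Definition insert_max (k : nat) (s : bool) (w : seq int) : seq int :=
  take k w ++ (-1) ^+ s * (size w).+1%:Z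
    :: (if s then [seq - x | x <- drop k w] else drop k w).

Lemma alternating_insert_max k (w : seq int) :
  (forall x, x \in w -> absz x < (size w).+1)%N -> (k <= size w)%N ->
  (alternating (insert_max k false w) + alternating (insert_max k true w)
   = (alternating (take k w) && alternating (drop k w))
     + ((k == 0) && (w == [::])))%N.
Proof.
move=> bw kw; rewrite !alternating_zigzag /insert_max !zigzag_cat !zigzag_rcons.
rewrite size_takel // !addTb mul1r mulN1r /=.
(* The inserted letter has a left neighbour only when k > 0; for k = 0 the value of [last] is just
   the default 0. *)
have bt : (k == 0)%N \/ - (size w).+1%:Z < last 0 (take k w) < (size w).+1%:Z.
  case: k kw => [|k] kw; [by left|right].
  have /bw : last 0 (take k.+1 w) \in w.
    apply: (@mem_take k.+1).
    by case: w kw {bw} => //= x w _; rewrite mem_last.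
  lia.
have -> : nilp (take k w) = (k == 0)%N by rewrite /nilp size_takel.
rewrite zigzag_opp negbK.
have bd x : x \in drop k w -> - (size w).+1%:Z < x < (size w).+1%:Z.
  by move/mem_drop/bw; lia.
have ew : (k == 0)%N && (w == [::]) = (k == 0)%N && nilp (drop k w).
  by case: k {kw bt bd} => // ; rewrite drop0 /nilp size_eq0.
rewrite {}ew.
set M := (size w).+1%:Z in bt bd *; set l := last 0 (take k w) in bt *.
have cmp x : - M < x < M ->
    [/\ (M < x) = false, (x < M) = true, (- M < x) = true & (x < - M) = false].
  by case/andP=> Mx xM; rewrite Mx xM !ltNge !ltW.
case: (posnP k) bt => [k0 _|k0 [|/cmp[-> -> -> ->]]]; last 2 first.
- by case: (k) k0.
(* For k > 0 the comparison with the left neighbour rejects one of the two signs, according to the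
   parity of k; the comparison with the right neighbour, if any, agrees. *)
- rewrite /= addn0; case: (drop k w) bd => [|y v] bd /=.
    by case: odd; rewrite /= !andbT ?andbF ?addn0.
  have [yM yM' My My'] := cmp y (bd y (mem_head _ _)).
  rewrite ltrN2 [- y < - M]ltrN2 yM' yM.
  by case: odd; rewrite /= ?andbT ?andbF ?add0n ?addn0.
(* For k = 0 the sign is decided by the first comparison, an ascent, which leaves only the negative
   letter; if w is empty there is no comparison and both signs count. *)
rewrite k0 take0 /= in bd *; case: (drop 0 w) bd => [//|y v] bd /=.
have [yM yM' My My'] := cmp y (bd y (mem_head _ _)).
by rewrite ltrN2 yM' yM addn0.
Qed.

(** * Sign vectors and standardization *)

Definition signed (e : seq bool) (u : seq int) : seq int :=
  [seq (-1) ^+ x.1 * x.2 | x : bool * int <- zip e u].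

Lemma size_signed e u : size e = size u -> size (signed e u) = size u.
Proof. by move=> sz; rewrite size_map size2_zip ?sz. Qed.

Lemma nth_signed e (u : seq int) i : size e = size u -> (i < size u)%N ->
  (signed e u)`_i = (-1) ^+ nth false e i * u`_i.
Proof.
move=> sz iu; rewrite (nth_map (false, 0)) ?nth_zip //.
by rewrite size2_zip ?sz.
Qed.

Lemma size_pword n (s : 'S_n) : size (pword s) = n.
Proof. by rewrite size_map size_enum_ord. Qed.

Lemma nth_pword n (s : 'S_n) (i : 'I_n) : (pword s)`_i = (s i).+1%:Z.
Proof. by rewrite (nth_map i) ?size_enum_ord // nth_ord_enum. Qed.

Lemma pword_inj n : injective (@pword n).
Proof.
move=> s t est; apply/permP => i; apply/val_inj.
by have := congr1 (fun w : seq int => w`_i) est; rewrite !nth_pword => -[].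
Qed.

Lemma pword_uniq n (s : 'S_n) : uniq (pword s).
Proof. by rewrite map_inj_uniq ?enum_uniq // => i j [] /val_inj/perm_inj. Qed.

Lemma pword_gt0 n (s : 'S_n) : {in pword s, forall x, 0 < x}.
Proof. by move=> x /mapP[i _ ->]. Qed.

Lemma word_signed n (p : sperm n) : word p = signed p.2 (pword p.1).
Proof.
apply: (@eq_from_nth _ 0); first by rewrite size_word size_signed size_pword ?size_tuple.
move=> i; rewrite size_word => lti; rewrite (nth_word p (Ordinal lti)).
rewrite nth_signed ?size_pword ?size_tuple //.
by rewrite (nth_pword p.1 (Ordinal lti)) (tnth_nth false).
Qed.

Lemma take_signed k e u : size e = size u ->
  take k (signed e u) = signed (take k e) (take k u).
Proof.
elim: k e u => [|k IH] [|x e] [|y u] //= [sz].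
by rewrite -/(signed e u) IH.
Qed.

Lemma drop_signed k e u : size e = size u ->
  drop k (signed e u) = signed (drop k e) (drop k u).
Proof.
elim: k e u => [|k IH] [|x e] [|y u] //= [sz].
by rewrite -/(signed e u) IH.
Qed.

Lemma std_gt0 w : {in std w, forall x, 0 < x}.
Proof.
move=> _ /mapP[x xw ->]; rewrite ltz_nat -has_count.
by apply/hasP; exists x => /=.
Qed.

(** Opposite signs decide the comparison by positivity alone; two negative signs reverse it, whence
    the hypothesis on both orders. *)
Lemma signed_lt (s t : bool) (x y x' y' : int) :
  0 < x -> 0 < y -> 0 < x' -> 0 < y' ->
  (x < y) = (x' < y') -> (y < x) = (y' < x') ->
  ((-1) ^+ s * x < (-1) ^+ t * y) = ((-1) ^+ s * x' < (-1) ^+ t * y').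
Proof. by case: s; case: t; rewrite ?mulN1r ?mul1r; lia. Qed.

Lemma alternating_signed_std e (u : seq int) :
  size e = size u -> {in u, forall x, 0 < x} ->
  alternating (signed e (std u)) = alternating (signed e u).
Proof.
move=> sz u_gt0; apply: alternating_eq.
  by rewrite !size_signed ?size_std.
move=> i j; rewrite size_signed ?size_std // => iu ju.
rewrite !nth_signed ?size_std //.
have ui := u_gt0 _ (mem_nth 0 iu); have uj := u_gt0 _ (mem_nth 0 ju).
have si : 0 < (std u)`_i by apply: (@std_gt0 u); rewrite mem_nth ?size_std.
have sj : 0 < (std u)`_j by apply: (@std_gt0 u); rewrite mem_nth ?size_std.
by apply: signed_lt; rewrite // std_mono.
Qed.

Lemma std_pword k (u : seq int) : uniq u -> size u = k ->
  exists s : 'S_k, pword s = std u.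
Proof.
move=> uu su; have pu := std_perm uu; rewrite su in pu.
(* The signed permutation obtained here has only positive letters, so its underlying permutation
   already spells [std u]. *)
have [p ep] : exists p : sperm k, word p = std u.
  apply: word_surj; rewrite -[iota 1 k]map_id.
  have -> : [seq id i | i <- iota 1 k] = map absz [seq k%:Z | k <- iota 1 k].
    by rewrite -map_comp; apply: eq_map.
  exact: perm_map.
exists p.1; apply: (@eq_from_nth _ 0); first by rewrite size_pword size_std su.
move=> i; rewrite size_pword => lti; rewrite (nth_pword _ (Ordinal lti)).
have := std_gt0 (w := u) (x := (std u)`_i).
rewrite mem_nth ?size_std ?su // => /(_ isT).
rewrite -ep (nth_word p (Ordinal lti)) /=.
by case: (tnth _ _); rewrite ?mulN1r ?mul1r.
Qed.

(** The first clause makes a sum over all signed permutations of size k, weighted by this test,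
    collapse to the single term a; the second evaluates that term. *)
Lemma standardization k (e : seq bool) (u : seq int) :
  size e = k -> size u = k -> uniq u -> {in u, forall x, 0 < x} ->
  exists a : sperm k,
    (forall a' : sperm k,
       (std u == pword a'.1) && (e == a'.2) = (a' == a))
    /\ alternating (word a) = alternating (signed e u).
Proof.
move=> se su uu u_gt0; have [s es] := std_pword uu su.
have [t et] : exists t : k.-tuple bool, e = t.
  by move/eqP: se => se; exists (Tuple se).
exists (s, t); split; last by rewrite word_signed /= es -et alternating_signed_std // se.
move=> [s' t']; rewrite -es et (inj_eq (@pword_inj k)) xpair_eqE.
by rewrite !(eq_sym s) -val_eqE (eq_sym (val t)).
Qed.

(** * Coefficients of the square of X *)

Section Coefficients.

Variable R : comNzRingType.

(** All terms of the product share one sign vector, and distinct terms have distinct permutations,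
    so at most one of them is the basis element of q. *)
Lemma mulG_coef k l (a : sperm k) (b : sperm l) (q : sperm (k + l)) :
  mulG R a b (Tagged sperm q)
  = (((std (take k (pword q.1)) == pword a.1) && (take k q.2 == a.2))
     && ((std (drop k (pword q.1)) == pword b.1) && (drop k q.2 == b.2)))%:R.
Proof.
rewrite /mulG; under eq_bigr do rewrite Gw_eq.
rewrite andbACA; have <- : (q.2 == [tuple of a.2 ++ b.2])
    = (take k q.2 == a.2) && (drop k q.2 == b.2).
  rewrite -val_eqE /= -{1}(cat_take_drop k q.2) eqseq_cat //.
  by rewrite size_takel ?size_tuple ?leq_addr.
case: q => s e /=; set T := cat_tuple _ _.
have [->|ne] := eqVneq e T; rewrite ?andbT ?andbF; last first.
  by apply: big1 => g _; rewrite xpair_eqE (negbTE ne) andbF.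
have [stds|nstds] := boolP (_ && _).
  rewrite (bigD1 s) //= eqxx big1 ?addr0 // => g /andP[_ gs].
  by rewrite xpair_eqE eq_sym (negbTE gs).
apply: big1 => g stdg; rewrite xpair_eqE eqxx andbT; case: eqP => //= sg.
by rewrite sg stdg in nstds.
Qed.

(** The size is constrained by an equation because [ser_mul] gives the second factor the size
    [tag q - k], whose sum with k is only provably [tag q]. *)
Lemma mul_alt_coef k l (q : sp) : tag q = (k + l)%N ->
  \sum_(a : sperm k) \sum_(b : sperm l)
     altX R (Tagged sperm a) * altX R (Tagged sperm b) * mulG R a b q
  = (alternating (take k (swd q)) && alternating (drop k (swd q)))%:R.
Proof.
case: q => n q /= en; subst n; rewrite /swd /=.
have sz : size q.2 = size (pword q.1) by rewrite size_tuple size_pword.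
rewrite word_signed take_signed // drop_signed //.
have [] := @standardization k (take k q.2) (take k (pword q.1)).
- by rewrite size_takel ?size_tuple ?leq_addr.
- by rewrite size_takel ?size_pword ?leq_addr.
- exact: take_uniq (pword_uniq _).
- by move=> x /mem_take; apply: pword_gt0.
move=> a [aP <-].
have [] := @standardization l (drop k q.2) (drop k (pword q.1)).
- by rewrite size_drop size_tuple addKn.
- by rewrite size_drop size_pword addKn.
- exact: drop_uniq (pword_uniq _).
- by move=> x /mem_drop; apply: pword_gt0.
move=> b [bP <-].
under eq_bigr => a' _ do under eq_bigr => b' _ do rewrite mulG_coef aP bP.
rewrite (bigD1 a) //= (bigD1 b) //= !eqxx mulr1 /altX /swd /= big1 ?addr0; last first.
  by move=> b' /negbTE ->; rewrite mulr0.
rewrite big1 ?addr0 => [|a' /negbTE na]; last first.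
  by apply: big1 => b' _; rewrite na mulr0.
by rewrite -natrM mulnb.
Qed.

Lemma ser_mul_alt_coef (q : sp) :
  ser_mul (altX R) (altX R) q
  = \sum_(k < (tag q).+1)
      (alternating (take k (swd q)) && alternating (drop k (swd q)))%:R.
Proof.
apply: eq_bigr => k _; apply: mul_alt_coef.
by rewrite subnKC // -ltnS.
Qed.

End Coefficients.

(** * The fibre of [dword] over a word w *)

Section InsertMax.

Variables (n : nat) (w : seq int).
Hypothesis perm_w : perm_eq (map absz w) (iota 1 n).

Lemma size_perm_iota : size w = n.
Proof. by rewrite -(size_map absz) (perm_size perm_w) size_iota. Qed.

Lemma absz_perm_iota x : x \in w -> (absz x < n.+1)%N.
Proof.
by move=> xw; have := map_f absz xw; rewrite (perm_mem perm_w) mem_iota; lia.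
Qed.

Lemma perm_insert_max k s :
  perm_eq (map absz (insert_max k s w)) (iota 1 n.+1).
Proof.
have -> : iota 1 n.+1 = iota 1 n ++ [:: n.+1].
  by have := iotaD 1 n 1; rewrite addn1 add1n.
rewrite /insert_max size_perm_iota map_cat /= abszMsign /=.
have -> : map absz (if s then [seq - x | x <- drop k w] else drop k w)
          = map absz (drop k w).
  by case: s => //; rewrite -map_comp; apply: eq_map => x /=; rewrite abszN.
rewrite -[n.+1 :: _]/([:: n.+1] ++ _) perm_catCA perm_catC perm_cat2r.
by rewrite -map_cat cat_take_drop.
Qed.

Lemma size_insert_max k s : size (insert_max k s w) = n.+1.
Proof.
by rewrite -(size_map absz) (perm_size (perm_insert_max k s)) size_iota.
Qed.

Lemma max_notin x : absz x = n.+1 -> x \notin w.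
Proof. by move=> ax; apply/negP => /absz_perm_iota; rewrite ax ltnn. Qed.

Lemma index_insert_max k (s : bool) : (k <= n)%N ->
  index ((-1) ^+ s * n.+1%:Z) (insert_max k s w) = k.
Proof.
move=> kn; rewrite /insert_max size_perm_iota index_cat ifN /=.
  by rewrite eqxx addn0 size_takel ?size_perm_iota.
by apply: contra _ (max_notin (abszMsign s n.+1)) => /mem_take.
Qed.

(** The position of n+1 among the absolute values recovers k, and the sign of the letter found there
    recovers s. *)
Lemma insert_max_inj k k' (s s' : bool) : (k <= n)%N -> (k' <= n)%N ->
  insert_max k s w = insert_max k' s' w -> (k, s) = (k', s').
Proof.
move=> kn k'n eq_ins.
have abs_index j (t : bool) : (j <= n)%N ->
    index n.+1 (map absz (insert_max j t w)) = j.
  move=> jn; rewrite map_cat index_cat ifN /=.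
    by rewrite size_perm_iota abszMsign eqxx addn0 size_map size_takel ?size_perm_iota.
  by apply/mapP => -[x /mem_take/absz_perm_iota + en]; rewrite -en ltnn.
have ek : k = k' by rewrite -(abs_index k s) // eq_ins abs_index.
have := congr1 (fun p : seq int => p`_k) eq_ins; rewrite -{}ek.
have nth_k (t : bool) : (insert_max k t w)`_k = (-1) ^+ t * n.+1%:Z.
  by rewrite nth_cat size_takel ?size_perm_iota // ltnn subnn.
by rewrite !nth_k; case: s {eq_ins}; case: s'.
Qed.

(** This selects the branch of [dword]. Negating the suffix cannot create n+1, since w does not
    contain its opposite either. *)
Lemma max_in_insert_max k (s : bool) : (n.+1%:Z \in insert_max k s w) = ~~ s.
Proof.
have nw := @max_notin n.+1%:Z erefl; have nw' := @max_notin (- n.+1%:Z) erefl.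
rewrite /insert_max mem_cat inE size_perm_iota; case: s => /=.
  apply/negP => /orP[/mem_take|/mapP[x /mem_drop xw ex]]; first exact/negP.
  by rewrite ex opprK xw in nw'.
by rewrite mul1r eqxx orbT.
Qed.

Lemma dword_insert_max k s : (k <= n)%N -> dword (insert_max k s w) = w.
Proof.
move=> kn; rewrite /dword size_insert_max max_in_insert_max.
have := index_insert_max s kn.
have st : size (take k w) = k by rewrite size_takel ?size_perm_iota.
case: s => /=; rewrite ?mulN1r ?mul1r => ->; rewrite /insert_max -cat_rcons;
  rewrite drop_size_cat ?size_rcons ?st // cat_rcons take_size_cat //=.
  by rewrite -map_comp map_id_in ?cat_take_drop // => x _ /=; rewrite opprK.
by rewrite cat_take_drop.
Qed.

(** Take for k and s the position and the sign of the letter of absolute value n+1; a negated suffix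
    is restored by negating again. With the two preceding facts, the pairs (k, s) parametrize the
    fibre bijectively. *)
Lemma dword_eq p : perm_eq (map absz p) (iota 1 n.+1) -> dword p = w ->
  exists k (s : bool), (k <= n)%N /\ p = insert_max k s w.
Proof.
move=> pp; have sp : size p = n.+1 by rewrite -(size_map absz) (perm_size pp) size_iota.
(* Both branches of [dword] are merged into one formula indexed by the sign s. *)
have [s xp ->] : exists2 s : bool, (-1) ^+ s * n.+1%:Z \in p & dword p
  = take (index ((-1) ^+ s * n.+1%:Z) p) p ++
    let v := drop (index ((-1) ^+ s * n.+1%:Z) p).+1 p in
    if s then [seq - x | x <- v] else v.
  rewrite /dword sp; case: ifP => [np|nnp].
    by exists false; rewrite mul1r.
  exists true; rewrite mulN1r //.
  have: n.+1 \in map absz p by rewrite (perm_mem pp) mem_iota; lia.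
  case/mapP => x xp nx; have [e|e] : x = n.+1%:Z \/ x = - n.+1%:Z by lia.
    by rewrite -e xp in nnp.
  by rewrite -e.
set x := _ * _ in xp *; set k := index x p => /= ew.
have kp : (k < size p)%N by rewrite index_mem.
have sk : size (take k p) = k by rewrite size_takel // ltnW.
exists k, s; split; first by rewrite -ltnS -sp.
rewrite /insert_max size_perm_iota -ew take_size_cat // drop_size_cat // -/x.
rewrite -[LHS](cat_take_drop k) (drop_nth 0) // nth_index //.
case: (s) => //; rewrite -map_comp map_id_in // => y _ /=; exact: opprK.
Qed.

End InsertMax.

(** * Coefficients of dX and the final comparison *)

Lemma ser_d_alt_coef (R : comNzRingType) (q : sp) :
  ser_d (altX R) q
  = \sum_(k < (tag q).+1)
      (alternating (insert_max k false (swd q))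
       + alternating (insert_max k true (swd q)))%:R.
Proof.
case: q => n q; set w := swd _; rewrite /ser_d /=.
have pw : perm_eq (map absz w) (iota 1 n) := perm_word q.
have ins (ks : 'I_n.+1 * bool) :
    exists p : sperm n.+1, word p = insert_max ks.1 ks.2 w.
  exact: word_surj (perm_insert_max pw _ _).
(* Finite choice turns the inserted words into signed permutations, over which the sum can be
   reindexed. *)
have [h hP] := fin_all_exists ins.
have h_inj : injective h.
  move=> [k s] [k' s'] /(congr1 (@word _)); rewrite !hP /=.
  case/(insert_max_inj pw (ltn_ord k) (ltn_ord k')) => /val_inj -> ->.
  by [].
(* The image of h is exactly the fibre of [dword] over w; outside it the coefficient of [dG] at q
   vanishes. *)
transitivity (\sum_(p in h @: setT) altX R (Tagged sperm p)).
  rewrite [RHS]big_mkcond; apply: eq_bigr => p _.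
  have -> : (p \in h @: setT) = (dword (word p) == w).
    apply/imsetP/eqP => [[ks _ ->]|/(dword_eq pw (perm_word p)) [k [s [kn ep]]]].
      by rewrite hP (dword_insert_max pw) // -ltnS.
    exists (Ordinal (kn : (k < n.+1)%N), s) => //.
    by apply: word_inj; rewrite hP.
  rewrite /dG /Gw /= -/w eq_sym.
  by case: eqP => _; rewrite ?mulr1 ?mulr0.
rewrite big_imset => [|? ? _ _]; last exact: h_inj.
under eq_bigl do rewrite inE.
under eq_bigr do rewrite /altX /swd /= hP.
rewrite -(pair_bigA _ (fun (k : 'I_n.+1) (s : bool) =>
                         (alternating (insert_max k s w))%:R)) /=.
by apply: eq_bigr => k _; rewrite big_bool natrD addrC.
Qed.

Theorem theorem5p1 (R : comNzRingType) :
  ser_d (altX R) =1 ser_add (ser_one R) (ser_mul (altX R) (altX R)).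
Proof.
move=> q; rewrite ser_d_alt_coef /ser_add ser_mul_alt_coef.
have pw := perm_word (tagged q); rewrite -/(swd q) in pw.
have sw := size_perm_iota pw.
under eq_bigr => k _.
  rewrite alternating_insert_max ?sw; first rewrite natrD; last exact: (ltn_ord k).
    over.
  by move=> x; apply: (absz_perm_iota pw).
rewrite big_split addrC; congr (_ + _) => /=.
(* Of the correction terms only the one at k = 0 remains; it tests whether the word is empty, which
   is the coefficient of the unit. *)
by rewrite big_ord_recl /= big1 ?addr0.
Qed.
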